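(* Let $(G,\sigma)$ be a flow-admissible signed cubic graph. If $G$ is a Kotzig graph, then $F((G,\sigma)) \le 6$.
   Context: Graphs are finite and may have parallel edges but no loops. A Kotzig graph is a cubic graph that has three $1$-factors such that the union of any two of them induces a hamiltonian circuit. A signed graph $(G,\sigma)$ is a graph $G$ with a function (signature) $\sigma: E(G)\to\{\pm1\}$. Each edge $e=uv$ is divided into two half-edges $h_e^u$ (incident with $u$) and $h_e^v$ (incident with $v$); $H(G)$ is the set of half-edges, $H(v)$ the set of half-edges incident with $v$, and $e_h$ the edge containing the half-edge $h$. An orientation of $(G,\sigma)$ is a function $\tau: H(G)\to\{\pm1\}$ with $\tau(h_e^u)\tau(h_e^v) = -\sigma(e)$ for each edge $e=uv$. Given an orientation $\tau$, the boundary of $f:E(G)\to\mathbb{R}$ is $\delta f(v)=\sum_{h\in H(v)}\tau(h)f(e_h)$. For real $r\ge 2$, $f$ is an $r$-flow on $(G,\sigma)$ if, for every edge $e$, $f(e)=0$ or $1\le |f(e)|\le r-1$, and $\delta f(v)=0$ for all $v\in V(G)$; it is nowhere-zero if $f(e)\ne 0$ for all $e$. $(G,\sigma)$ admits a nowhere-zero $r$-flow if one exists for some orientation, and $(G,\sigma)$ is flow-admissible if it admits a nowhere-zero $r$-flow for some $r\ge2$. $F((G,\sigma))$ is the smallest integer $k$ such that $(G,\sigma)$ admits an integer-valued nowhere-zero $k$-flow. *)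

(* Defs.v *)
From mathcomp Require Import all_boot all_order all_algebra.
From mathcomp Require Import reals.

Set Implicit Arguments.
Unset Strict Implicit.
Unset Printing Implicit Defensive.

Import Order.TTheory GRing.Theory Num.Theory.
Local Open Scope ring_scope.

(* Each edge [e] has the two half-edges [(e, false)] and [(e, true)], and
   [endpoint] gives the vertex that a half-edge is incident with; parallel
   edges are different elements of [edge] with the same endpoints. *)
Record multigraph := Multigraph {
  vertex : finType;
  edge : finType;
  endpoint : edge * bool -> vertex;
  loopless : forall e : edge, endpoint (e, false) != endpoint (e, true)
}.

Definition halfedge (G : multigraph) : finType := (edge G * bool)%type.

Section Graph.
Variable G : multigraph.
Implicit Types (v : vertex G) (C M : {set edge G}).

Definition halfedges_at v : {set halfedge G} := [set h | endpoint h == v].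

Definition degree_in C v : nat := #|[set h in halfedges_at v | h.1 \in C]|.

Definition cubic : Prop := forall v, degree_in [set: edge G] v = 3%N.

Definition one_factor M : Prop := forall v, degree_in M v = 1%N.

Definition adjacent_in C : rel (vertex G) :=
  fun u v => [exists h : halfedge G,
    [&& h.1 \in C, endpoint h == u & endpoint (h.1, ~~ h.2) == v]].

(* The subgraph induced by [C], whose vertices are those incident with an edge
   of [C], is a circuit: nonempty, connected and 2-regular.  Two parallel edges
   form a circuit of length 2. *)
Definition circuit C : Prop :=
  [/\ C != set0,
      forall v, (0 < degree_in C v)%N -> degree_in C v = 2%N
    & forall u v, (0 < degree_in C u)%N -> (0 < degree_in C v)%N ->
        connect (adjacent_in C) u v].

Definition hamiltonian_circuit C : Prop :=
  circuit C /\ forall v, (0 < degree_in C v)%N.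

(* The three 1-factors need not be required to be distinct: the union of a
   1-factor with itself does not induce a circuit. *)
Definition kotzig : Prop :=
  cubic /\
  exists M1 M2 M3 : {set edge G},
    [/\ one_factor M1, one_factor M2 & one_factor M3] /\
    [/\ hamiltonian_circuit (M1 :|: M2),
        hamiltonian_circuit (M1 :|: M3)
      & hamiltonian_circuit (M2 :|: M3)].

(* A sign is encoded as a boolean [b] standing for [(-1) ^+ b], so that
   [false] is +1 and [true] is -1. *)
Definition signature : Type := edge G -> bool.

Definition is_orientation (sigma : signature) (tau : halfedge G -> bool) :
    Prop :=
  forall e : edge G,
    (-1) ^+ tau (e, false) * (-1) ^+ tau (e, true) = - (-1) ^+ sigma e :> int.

Section Flow.
Variable R : realType.
Implicit Types (f : edge G -> R) (tau : halfedge G -> bool) (r : R).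

Definition boundary tau f v : R :=
  \sum_(h in halfedges_at v) (-1) ^+ tau h * f h.1.

Definition is_flow tau r f : Prop :=
  [/\ 2 <= r,
      forall e, f e = 0 \/ 1 <= `|f e| <= r - 1
    & forall v, boundary tau f v = 0].

Definition nowhere_zero f : Prop := forall e, f e != 0.

Definition admits_nz_flow (sigma : signature) r : Prop :=
  exists tau f, [/\ is_orientation sigma tau, is_flow tau r f & nowhere_zero f].

Definition flow_admissible (sigma : signature) : Prop :=
  exists r, admits_nz_flow sigma r.

Definition admits_integer_nz_flow (sigma : signature) (k : nat) : Prop :=
  exists tau f,
    [/\ is_orientation sigma tau, is_flow tau k%:R f, nowhere_zero f
      & forall e, f e \is a Num.int].

(* [F((G, sigma)) = k], as a relation because the minimum may not exist. *)
Definition is_integer_flow_number (sigma : signature) (k : nat) : Prop :=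
  admits_integer_nz_flow sigma k /\
  forall j : nat, admits_integer_nz_flow sigma j -> (k <= j)%N.

End Flow.
End Graph.

Arguments flow_admissible {G} R sigma.
Arguments is_integer_flow_number {G} R sigma k.

(* Main.v *)
Require Import Defs.
From mathcomp Require Import all_boot all_order all_algebra.
From mathcomp Require Import reals.
From mathcomp Require Import boolp ring.

Set Implicit Arguments.
Unset Strict Implicit.
Unset Printing Implicit Defensive.

Import Order.TTheory GRing.Theory Num.Theory.
Local Open Scope ring_scope.

(** Write M1, M2, M3 for the three 1-factors, and fix the orientation tau of
    some nowhere-zero flow f0.  A sign pattern (-1)^y on a hamiltonian circuit
    Mi + Mj has boundary 0 or 2 or -2 at each vertex; call a vertex of the
    second kind a defect.  Which sets of defects are possible depends only on
    their parity, by the existence of T-joins in the connected graph Mi + Mj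
    ([even_join], [signing]).  Let p_i be the parity of the number of vertices
    whose Mi-half-edge has tau negative: then Mi + Mj has a sign pattern without
    defects, that is, it is balanced, exactly when p_i = p_j.  Two of the three
    parities agree, say p_1 = p_2, so M1 + M2 carries a flow phi of values +-1.

    If p_3 agrees as well, M1 + M3 also carries a flow phi' of values +-1, and
    phi + 2 phi' has absolute values 1, 2 and 3 ([equal_parity_flow]).

    Otherwise M1 + M3 has a sign pattern zeta with a single defect, at any
    chosen vertex r.  Because M1 + M2 is balanced, switching at some vertices
    makes all its edges positive ([potential12]); after that the boundaries of
    any function on the edges sum up to a signed sum over the negative edges of
    M3, each counted at both its ends ([sum_excess]).  For zeta this sum is +-2.  If
    every term had the same sign, there would be a single negative edge, and
    then the sum for f0 could not vanish.  So there is a negative edge e = uw of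
    M3 at whose ends zeta has the sign opposite to that of the defect at r.
    Doubling zeta on e gives a function with boundary 2, -1, -1 (up to a common
    sign) at r, u, w and 0 elsewhere.  On M1 + M2 there are sign patterns that
    transfer 2 units from r to u and from r to w ([transfer]); half their sum
    has values in {-1, 0, 1} and cancels this boundary.  What results is a flow
    with values at most 2 on M1, at most 1 on M2, and 1 or 2 on M3; adding 3 phi
    makes it nowhere zero with absolute values at most 5
    ([odd_parity_flow]). *)

(** * Parities of boolean families *)

Definition parity (I : finType) (F : I -> bool) : bool :=
  \big[addb/false]_i F i.

Section Parity.
Variable I : finType.
Implicit Types (F : I -> bool) (i : I).

Lemma eq_parity F F' : F =1 F' -> parity F = parity F'.
Proof. by move=> FF'; apply: eq_bigr => i _; apply: FF'. Qed.

Lemma parity_addb F F' :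
  parity (fun i => F i (+) F' i) = parity F (+) parity F'.
Proof. exact: big_split. Qed.

Lemma parity_eq1 i : parity (eq_op^~ i) = true.
Proof.
rewrite /parity (bigD1 i) //= eqxx big1 // => j; exact: negbTE.
Qed.

Lemma parity_odd F : parity F = odd (\sum_i F i).
Proof.
rewrite (big_morph odd oddD (erefl : odd 0 = false)).
by apply: eq_bigr => i _; case: (F i).
Qed.

End Parity.

(** * The half-edges of a 1-factor *)

Section Selectors.
Variable G : multigraph.
Implicit Types (C M : {set edge G}) (k : halfedge G) (v : vertex G).
Implicit Types (h : vertex G -> halfedge G).

Definition opp k : halfedge G := (k.1, ~~ k.2).

Lemma oppK : involutive opp.
Proof. by case=> e b; rewrite /opp /= negbK. Qed.

Lemma endpoint_opp_neq k : endpoint (opp k) != endpoint k.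
Proof.
by case: k => e []; rewrite /opp /=; [|rewrite eq_sym]; exact: loopless.
Qed.

Lemma eq_edge k k' : (k.1 == k'.1) = (k == k') || (k == opp k').
Proof.
case: k k' => [e b] [e' b']; rewrite /opp !xpair_eqE /=.
by case: eqP; case: b; case: b'.
Qed.

(** A 1-factor is handled through the function that gives its half-edge at each
    vertex: sums over half-edges then become sums over vertices, and the two
    halves of an edge are exchanged by the involution [mate]. *)
Definition selects M h : Prop :=
  (forall v, endpoint (h v) = v) /\
  (forall k, (k.1 \in M) = (k == h (endpoint k))).

Lemma one_factor_selects M : one_factor M -> exists h, selects M h.
Proof.
move=> M1.
have ex_half v : exists k, [set h in halfedges_at v | h.1 \in M] = [set k].
  by apply/cards1P; rewrite -/(degree_in M v) M1.
have [h hE] := fin_all_exists ex_half; exists h.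
have hP k v : (endpoint k == v) && (k.1 \in M) = (k == h v).
  by move/setP/(_ k): (hE v); rewrite !inE.
by split=> [v | k]; [have := hP (h v) v | have := hP k (endpoint k)];
  rewrite eqxx => // /andP[/eqP].
Qed.

Definition mate h v : vertex G := endpoint (opp (h v)).

Section OneSelector.
Variables (M : {set edge G}) (h : vertex G -> halfedge G).
Hypothesis hM : selects M h.

Lemma endpoint_sel v : endpoint (h v) = v.
Proof. exact: hM.1. Qed.

Lemma sel_edge_in v : (h v).1 \in M.
Proof. by rewrite hM.2 endpoint_sel. Qed.

Lemma selK k : k.1 \in M -> h (endpoint k) = k.
Proof. by rewrite hM.2 => /eqP <-. Qed.

Lemma sel_mate v : h (mate h v) = opp (h v).
Proof. by rewrite /mate selK ?sel_edge_in. Qed.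

Lemma mateK : involutive (mate h).
Proof. by move=> v; rewrite {1}/mate sel_mate oppK endpoint_sel. Qed.

Lemma mate_neq v : mate h v != v.
Proof. by rewrite -[v in X in _ != X]endpoint_sel endpoint_opp_neq. Qed.

Lemma eq_sel_edge v w : ((h w).1 == (h v).1) = (w == v) || (w == mate h v).
Proof.
have h_inj : injective h := can_inj endpoint_sel.
by rewrite eq_edge -sel_mate !(inj_eq h_inj).
Qed.

Lemma big_mate (A : Type) (idx : A) (op : Monoid.com_law idx)
    (P : pred (vertex G)) (F : halfedge G -> A) :
  \big[op/idx]_(v | P v) F (h v)
    = \big[op/idx]_(v | P (mate h v)) F (opp (h v)).
Proof.
rewrite (reindex_inj (inv_inj mateK)).
by apply: eq_bigr => v _; rewrite sel_mate.
Qed.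

(** Of the two halves of an edge exactly one is the half [true]. *)
Lemma sum_sides : (#|vertex G| = (\sum_v (h v).2).*2)%N.
Proof.
rewrite -addnn [in X in (X + _)%N](@big_mate _ _ _ xpredT (fun k => k.2 : nat)).
rewrite -big_split -sum1_card.
by apply: eq_bigr => v _ /=; case: (h v).2.
Qed.

Lemma parity_true : parity (fun _ : vertex G => true) = false.
Proof. by rewrite parity_odd /= sum1_card sum_sides odd_double. Qed.

End OneSelector.

(** Any two 1-factors have the same number of edges; only the parity of this
    number matters for two-colouring the circuit that they form. *)
Lemma parity_sides M M' h h' : selects M h -> selects M' h' ->
  parity (fun v => (h v).2) = parity (fun v => (h' v).2).
Proof.
move=> hM hM'; rewrite !parity_odd; congr odd.
by apply: double_inj; rewrite -(sum_sides hM) -(sum_sides hM').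
Qed.

(** * Sign patterns on a hamiltonian circuit formed by two 1-factors *)

Section TwoFactors.
Variables (M M' : {set edge G}) (h h' : vertex G -> halfedge G).
Hypotheses (hM : selects M h) (hM' : selects M' h').
Hypothesis hamMM' : hamiltonian_circuit (M :|: M').

Lemma sel_neq v : h v != h' v.
Proof.
have [[_ reg _] pos] := hamMM'.
apply/eqP => hh'; have := reg v (pos v).
suff -> : degree_in (M :|: M') v = #|[set h v]| by rewrite cards1.
apply: eq_card => k; rewrite !inE hM.2 hM'.2.
have [-> | kv] := eqVneq (endpoint k) v.
  by rewrite -hh' orbb.
apply/esym/negbTE; apply: contra kv => /eqP->.
by rewrite (endpoint_sel hM).
Qed.

Lemma sel_edge_notin v : (h v).1 \notin M'.
Proof. by rewrite hM'.2 (endpoint_sel hM) sel_neq. Qed.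

Lemma sel_edge_notin' v : (h' v).1 \notin M.
Proof. by rewrite hM.2 (endpoint_sel hM') eq_sym sel_neq. Qed.

(** Adding modulo 2 the edges of a walk from [u] to [w] leaves an edge set in
    which only [u] and [w] have odd degree. *)
Lemma path_join u w : exists y : edge G -> bool,
  forall v, y (h v).1 (+) y (h' v).1 = (v == u) (+) (v == w).
Proof.
have [[_ _ conn] pos] := hamMM'.
have /connectP[p] := conn u w (pos u) (pos w).
elim: p u => [|u' p IHp] u /=.
  by move=> _ ->; exists xpred0 => v; rewrite !addbb.
case/andP=> /existsP[k /and3P[kMM' /eqP ku /eqP ku']] /IHp{}IHp /IHp[y yP].
exists (fun e => y e (+) (e == k.1)) => v.
rewrite addbACA yP.
suff -> : ((h v).1 == k.1) (+) ((h' v).1 == k.1) = (v == u) (+) (v == u').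
  by case: (v == u); case: (v == u'); case: (v == w).
have uu' : u != u' by rewrite -ku -ku' eq_sym endpoint_opp_neq.
have xor_or : (v == u) (+) (v == u') = (v == u) || (v == u').
  by have [->|] := eqVneq v u; rewrite ?(negbTE uu').
move: kMM'; rewrite inE => /orP[kM | kM'].
  have kh : k = h u by rewrite -ku (selK hM).
  have -> : u' = mate h u by rewrite -ku' /mate -kh.
  have /negbTE-> : (h' v).1 != k.1.
    by apply: contra (sel_edge_notin' v) => /eqP->.
  rewrite addbF kh (eq_sel_edge hM) -[mate h u]/(endpoint (opp (h u))) -kh.
  by rewrite [endpoint (opp k)]ku' xor_or.
have kh : k = h' u by rewrite -ku (selK hM').
have /negbTE-> : (h v).1 != k.1.
  by apply: contra (sel_edge_notin v) => /eqP->.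
rewrite /= kh (eq_sel_edge hM') -[mate h' u]/(endpoint (opp (h' u))) -kh.
by rewrite [endpoint (opp k)]ku' xor_or.
Qed.

(** Every vertex set [c] of even size has a T-join: join each of its vertices
    to a fixed root [r] and add these walks up; the degree of [r] comes out
    right because [c] is even. *)
Lemma even_join (c : vertex G -> bool) : parity c = false ->
  exists y : edge G -> bool, forall v, y (h v).1 (+) y (h' v).1 = c v.
Proof.
move=> c0; have [r _ | V0] := pickP (vertex G); last first.
  by exists xpred0 => v; have := V0 v.
have [Y YP] := fin_all_exists (path_join r).
exists (fun e => parity (fun w => c w && Y w e)) => v.
rewrite -parity_addb.
rewrite (eq_parity (F' := fun w => (c w && (v == r)) (+) (c w && (v == w)))).
  2: by move=> w; have := YP w v; case: (c w).
rewrite parity_addb.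
have -> : parity (fun w => c w && (v == r)) = false.
  by rewrite /parity -big_distrl /= -/(parity c) c0.
rewrite /parity (bigD1 v) //= eqxx andbT big1 ?addbF // => w /negbTE wv.
by rewrite eq_sym wv andbF.
Qed.

(** The pattern (-1)^y has its defects exactly at [c]: the two terms
    (-1)^(tau + y) at a vertex are equal on [c], and opposite elsewhere. *)
Lemma signing (tau : halfedge G -> bool) (c : vertex G -> bool) :
    parity c = parity (tau \o h) (+) parity (tau \o h') ->
  exists y : edge G -> bool, forall v,
    y (h v).1 (+) y (h' v).1 = ~~ (tau (h v) (+) tau (h' v) (+) c v).
Proof.
move=> c_par.
apply: (even_join (c := fun v => true (+) (tau (h v) (+) tau (h' v) (+) c v))).
by rewrite !parity_addb (parity_true hM) c_par addbb.
Qed.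

(** On the circuit, M-edges and M'-edges alternate.  Orienting every edge from
    one half to the other, a set of edges can be reversed so that each vertex
    becomes a source or a sink; sources and sinks are the two classes. *)
Lemma bipartition : exists beta : vertex G -> bool,
  forall k, k.1 \in M :|: M' -> beta (endpoint (opp k)) = ~~ beta (endpoint k).
Proof.
have [|z zP] := @even_join (fun v => (h v).2 (+) (h' v).2).
  by rewrite parity_addb (parity_sides hM hM') addbb.
have zP' v : z (h v).1 (+) (h v).2 = z (h' v).1 (+) (h' v).2.
  by move: (zP v); case: (z _); case: (z _); case: (h v).2; case: (h' v).2.
exists (fun v => z (h v).1 (+) (h v).2) => k; rewrite inE => /orP[kM|kM'].
  by rewrite !(selK hM) //= addbN.
by rewrite !zP' !(selK hM') //= addbN.
Qed.

End TwoFactors.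

(** * Signed sums over the vertices *)

Section SignedSums.
Variable A : numDomainType.
Implicit Types (tau s : halfedge G -> bool) (f : edge G -> A).

(** The boundary of an edge function with values in any ordered ring: the given
    flow is real, while the flow to be constructed is computed in [int]. *)
Definition excess tau f v : A :=
  \sum_(k in halfedges_at v) (-1) ^+ tau k * f k.1.

(** The two halves of an edge where [s] differs cancel each other. *)
Lemma sum_negative_edges M h s f : selects M h ->
  \sum_v (-1) ^+ s (h v) * f (h v).1
    = \sum_(v | s (opp (h v)) == s (h v)) (-1) ^+ s (h v) * f (h v).1.
Proof.
move=> hM; rewrite (bigID (fun v => s (opp (h v)) == s (h v))) /=.
rewrite [X in _ + X](_ : _ = 0) ?addr0 //.
apply/eqP; rewrite -eqNr; apply/eqP.
rewrite [RHS](@big_mate _ _ hM _ _ _ _ (fun k => (-1) ^+ s k * f k.1)).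
rewrite -sumrN; apply: eq_big => v.
  by rewrite (sel_mate hM) oppK eq_sym.
rewrite /opp /=; case: (s _); case: (s _) => //= _;
by rewrite ?expr1 ?expr0; ring.
Qed.

Lemma sum_antisymmetric M h s f : selects M h ->
    (forall k, k.1 \in M -> s (opp k) = ~~ s k) ->
  \sum_v (-1) ^+ s (h v) * f (h v).1 = 0.
Proof.
move=> hM sN; rewrite (sum_negative_edges s f hM) big_pred0 // => v.
by rewrite sN ?(sel_edge_in hM) //; case: (s _).
Qed.

Lemma sign_neq0 (b : bool) : (-1) ^+ b != 0 :> A.
Proof. by rewrite signr_eq0. Qed.

(** The boundary of a sign pattern at a vertex, as [signing] describes it. *)
Lemma signs_at_vertex (b b' y y' c : bool) : y (+) y' = ~~ (b (+) b' (+) c) ->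
  (-1) ^+ b * (-1) ^+ y + (-1) ^+ b' * (-1) ^+ y'
    = 2 * (-1) ^+ (b (+) y) * c%:R :> A.
Proof.
by move: b b' y y' c => [] [] [] [] [] //= _; rewrite ?expr1 ?expr0; ring.
Qed.

End SignedSums.

(** * Flows on a cubic graph with three hamiltonian pairs of 1-factors *)

Section ThreeFactors.
Variables (M1 M2 M3 : {set edge G}) (h1 h2 h3 : vertex G -> halfedge G).
Hypotheses (hM1 : selects M1 h1) (hM2 : selects M2 h2) (hM3 : selects M3 h3).
Hypotheses (ham12 : hamiltonian_circuit (M1 :|: M2))
           (ham13 : hamiltonian_circuit (M1 :|: M3))
           (ham23 : hamiltonian_circuit (M2 :|: M3)).
Hypothesis Gcubic : cubic G.
Variable tau : halfedge G -> bool.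

Lemma halfedges_at_cubic v : halfedges_at v = [set h1 v; h2 v; h3 v].
Proof.
have n12 := sel_neq hM1 hM2 ham12 v.
have n13 := sel_neq hM1 hM3 ham13 v.
have n23 := sel_neq hM2 hM3 ham23 v.
apply/esym/eqP; rewrite eqEcard; apply/andP; split.
  apply/subsetP => k; rewrite !inE => /orP[/orP[]|] /eqP->;
  by rewrite ?(endpoint_sel hM1) ?(endpoint_sel hM2) ?(endpoint_sel hM3).
have -> : #|halfedges_at v| = 3%N.
  by rewrite -(Gcubic v); apply: eq_card => k; rewrite !inE andbT.
by rewrite setUC cardsU1 cards2 !inE negb_or n12 eq_sym n13 eq_sym n23.
Qed.

Lemma excess_cubic (A : numDomainType) (f : edge G -> A) v :
  excess tau f v = (-1) ^+ tau (h1 v) * f (h1 v).1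
    + (-1) ^+ tau (h2 v) * f (h2 v).1 + (-1) ^+ tau (h3 v) * f (h3 v).1.
Proof.
have n12 := sel_neq hM1 hM2 ham12 v.
have n13 := sel_neq hM1 hM3 ham13 v.
have n23 := sel_neq hM2 hM3 ham23 v.
rewrite /excess halfedges_at_cubic -setUA.
rewrite big_setU1 ?inE ?negb_or ?n12 ?n13 //=.
by rewrite big_setU1 ?inE //= big_set1 addrA.
Qed.

Definition by_factor (T : Type) (f1 f2 f3 : edge G -> T) e : T :=
  if e \in M1 then f1 e else if e \in M2 then f2 e else f3 e.

Lemma excess_by_factor (A : numDomainType) (f1 f2 f3 : edge G -> A) v :
  excess tau (by_factor f1 f2 f3) v = (-1) ^+ tau (h1 v) * f1 (h1 v).1
    + (-1) ^+ tau (h2 v) * f2 (h2 v).1 + (-1) ^+ tau (h3 v) * f3 (h3 v).1.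
Proof.
rewrite excess_cubic /by_factor (sel_edge_in hM1) (sel_edge_in hM2).
rewrite (negbTE (sel_edge_notin' hM1 hM2 ham12 v)).
rewrite (negbTE (sel_edge_notin' hM1 hM3 ham13 v)).
by rewrite (negbTE (sel_edge_notin' hM2 hM3 ham23 v)).
Qed.

Hypothesis even12 :
parity (tau \o h1) = parity (tau \o h2).

(** Switching at the vertices of [x] makes all edges of the balanced circuit
    M1 + M2 positive.  The signs of a flow phi of values +-1 on it, read at the
    M1-half-edge of each vertex, make every edge negative; the alternating
    colouring [beta] of the vertices then turns negative into positive. *)
Lemma potential12 : exists x : vertex G -> bool,
  forall k, k.1 \in M1 :|: M2 ->
    x (endpoint (opp k)) (+) tau (opp k) = ~~ (x (endpoint k) (+) tau k).
Proof.
have [beta betaP] := bipartition hM1 hM2 ham12.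
have [|y yP] := signing hM1 hM2 ham12 (tau := tau) (c := xpred0).
  by rewrite even12 addbb /parity big1.
exists (fun v => beta v (+) y (h1 v).1 (+) tau (h1 v)) => k k12.
rewrite betaP //; move: k12; rewrite inE => /orP[kM|kM].
  by rewrite !(selK hM1) //= -!addbA !addbb !addbF addNb.
have := yP (endpoint (opp k)); have := yP (endpoint k).
rewrite !(selK hM2) //=.
by do 4!move: (tau _); do 3!move: (y _); move: (beta _); do 8!case.
Qed.

(** When all three circuits are balanced, unit flows on two of them combine to
    a nowhere-zero flow with values in {1, 2, 3} up to sign. *)
Lemma equal_parity_flow :
    parity (tau \o h1) = parity (tau \o h3) ->
  exists f : edge G -> int,
    (forall e, 1 <= `|f e| <= 5) /\ (forall v, excess tau f v = 0).
Proof.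
move=> even13.
have [|y yP] := signing hM1 hM2 ham12 (tau := tau) (c := xpred0).
  by rewrite even12 addbb /parity big1.
have [|z zP] := signing hM1 hM3 ham13 (tau := tau) (c := xpred0).
  by rewrite even13 addbb /parity big1.
exists (by_factor (fun e => (-1) ^+ y e + 2 * (-1) ^+ z e)
   (fun e => (-1) ^+ y e) (fun e => 2 * (-1) ^+ z e)); split=> [e|v].
  rewrite /by_factor; case: ifP => _; [|case: ifP => _];
  by case: (y e); case: (z e).
rewrite excess_by_factor.
have := signs_at_vertex int (yP v).
have := signs_at_vertex int (zP v).
rewrite /= !mulr0 => z0 y0.
transitivity (0 + 2 * 0 : int) => //.
by rewrite -{1}y0 -z0; ring.
Qed.


(** In what follows [s] is the orientation after switching at [x]; an edge is
    positive when its two halves have different values of [s]. *)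
Section Potential.
Variable x : vertex G -> bool.
Let s k := x (endpoint k) (+) tau k.
Hypothesis potential : forall k, k.1 \in M1 :|: M2 -> s (opp k) = ~~ s k.

Lemma sum_weighted12 (A : numDomainType) (f : edge G -> A) :
  \sum_v (-1) ^+ s (h1 v) * f (h1 v).1 = 0
  /\ \sum_v (-1) ^+ s (h2 v) * f (h2 v).1 = 0.
Proof.
split.
  by apply: (sum_antisymmetric f hM1) => k kM; rewrite potential // inE kM.
by apply: (sum_antisymmetric f hM2) => k kM; rewrite potential // inE kM orbT.
Qed.

(** A sign pattern on M1 + M2 with defects at [u] and [r] only.  Since the
    circuit is positive after switching, the boundaries sum to zero, so those
    at [u] and [r] are opposite; negating the pattern gives either sign [b]. *)
Lemma transfer (u r : vertex G) (b : bool) : u != r ->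
  exists y : edge G -> bool, forall v,
    (-1) ^+ x v * ((-1) ^+ tau (h1 v) * (-1) ^+ y (h1 v).1
                   + (-1) ^+ tau (h2 v) * (-1) ^+ y (h2 v).1)
      = 2 * (-1) ^+ b * ((v == u)%:R - (v == r)%:R) :> int.
Proof.
move=> ur.
have [|y yP] := signing hM1 hM2 ham12
    (tau := tau) (c := fun v => (v == u) (+) (v == r)).
  by rewrite even12 addbb parity_addb !parity_eq1.
pose eta v := s (h1 v) (+) y (h1 v).1.
have etaP v : (-1) ^+ x v * ((-1) ^+ tau (h1 v) * (-1) ^+ y (h1 v).1
                   + (-1) ^+ tau (h2 v) * (-1) ^+ y (h2 v).1)
    = 2 * (-1) ^+ eta v * ((v == u) (+) (v == r))%:R :> int.
  rewrite (signs_at_vertex int (yP v)) /eta /s (endpoint_sel hM1) !signr_addb.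
  by ring.
have eta_r : eta r = ~~ eta u.
  have [S1 S2] := sum_weighted12 (fun e => (-1) ^+ y e : int).
  have : \sum_v (-1) ^+ x v * ((-1) ^+ tau (h1 v) * (-1) ^+ y (h1 v).1
                   + (-1) ^+ tau (h2 v) * (-1) ^+ y (h2 v).1) = 0 :> int.
    rewrite -[RHS]addr0 -[X in _ = X + _]S1 -[X in _ = _ + X]S2 -big_split.
    apply: eq_bigr => v _ /=.
    by rewrite /s (endpoint_sel hM1) (endpoint_sel hM2) !signr_addb; ring.
  under eq_bigr do rewrite etaP.
  have ru : r != u by rewrite eq_sym.
    rewrite (bigD1 u) //= (bigD1 r) //= big1 => [|v /andP[vu vr]].
    rewrite !eqxx (negbTE ur) (negbTE ru).
    by case: (eta r); case: (eta u).
  by rewrite (negbTE vu) (negbTE vr) mulr0.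
exists (fun e => y e (+) (eta u (+) b)) => v.
rewrite [y _ (+) _ in X in X + _]addbC [y _ (+) _ in X in _ + X]addbC !signr_addb.
transitivity ((-1) ^+ (eta u (+) b) *
    ((-1) ^+ x v * ((-1) ^+ tau (h1 v) * (-1) ^+ y (h1 v).1
                   + (-1) ^+ tau (h2 v) * (-1) ^+ y (h2 v).1)) : int).
  by rewrite !signr_addb; ring.
rewrite etaP; have [->|vu] := eqVneq v u.
  by rewrite (negbTE ur); case: (eta u); case: (b).
have [->|vr] := eqVneq v r; last by rewrite /= subrr !mulr0.
by rewrite eta_r; case: (eta u); case: (b).
Qed.

Lemma sum_excess (A : numDomainType) (f : edge G -> A) :
  \sum_v (-1) ^+ x v * excess tau f v
    = \sum_(v | s (opp (h3 v)) == s (h3 v)) (-1) ^+ s (h3 v) * f (h3 v).1.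
Proof.
have [S1 S2] := sum_weighted12 f.
rewrite -(sum_negative_edges s f hM3) -[RHS]add0r -[X in _ = X + _]S1
  -[RHS]add0r -[X in _ = X + _]S2 -!big_split.
apply: eq_bigr => v _; rewrite excess_cubic /s /=.
rewrite (endpoint_sel hM1) (endpoint_sel hM2) (endpoint_sel hM3) !signr_addb.
by ring.
Qed.

End Potential.

(** The case where M1 + M2 is balanced and M1 + M3 is not.  The nowhere-zero
    flow [f0] serves only to exclude that, after switching, M3 has exactly one
    negative edge. *)
Lemma odd_parity_flow (A : numDomainType) (f0 : edge G -> A) :
    (forall e, f0 e != 0) -> (forall v, excess tau f0 v = 0) ->
    parity (tau \o h1) != parity (tau \o h3) ->
  exists f : edge G -> int,
    (forall e, 1 <= `|f e| <= 5) /\ (forall v, excess tau f v = 0).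
Proof.
move=> f0_neq0 f0_flow odd13.
have [x xP] := potential12; pose s k := x (endpoint k) (+) tau k.
pose neg v := s (opp (h3 v)) == s (h3 v).
have neg_mate v : neg (mate h3 v) = neg v.
  by rewrite /neg (sel_mate hM3) oppK eq_sym.
have [r _ | V0] := pickP (vertex G); last first.
  by exists (fun=> 1); split=> // v; have := V0 v.
have [|y yP] := signing hM1 hM2 ham12 (tau := tau) (c := xpred0).
  by rewrite even12 addbb /parity big1.
(* By parity, z cannot do without a defect; a single one, at r, suffices. *)
have [|z zP] := signing hM1 hM3 ham13 (tau := tau) (c := eq_op^~ r).
  by rewrite parity_eq1; move: odd13; case: (parity _); case: (parity _).
pose theta := s (h1 r) (+) z (h1 r).1.
pose chi v := s (h3 v) (+) z (h3 v).1.
have zP' v : (-1) ^+ x v * ((-1) ^+ tau (h1 v) * (-1) ^+ z (h1 v).1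
              + (-1) ^+ tau (h3 v) * (-1) ^+ z (h3 v).1)
    = 2 * (-1) ^+ theta * (v == r)%:R :> int.
  rewrite (signs_at_vertex int (zP v)); have [->|_] := eqVneq v r; last first.
    by rewrite !mulr0.
  by rewrite /theta /s (endpoint_sel hM1) !signr_addb; ring.
have chi_r : chi r = theta.
  move: (zP r); rewrite eqxx /chi /theta /s (endpoint_sel hM1) (endpoint_sel hM3).
  by move: (x r); do 2!move: (tau _); do 2!move: (z _); do 5!case.
have sum_chi : \sum_(v | neg v) (-1) ^+ chi v = 2 * (-1) ^+ theta :> int.
  transitivity (\sum_v (-1) ^+ x v * ((-1) ^+ tau (h1 v) * (-1) ^+ z (h1 v).1
              + (-1) ^+ tau (h3 v) * (-1) ^+ z (h3 v).1) : int); last first.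
    under eq_bigr do rewrite zP'.
    rewrite (bigD1 r) //= eqxx mulr1 big1 ?addr0 // => v /negbTE->.
    by rewrite mulr0.
  have [S1 _] := sum_weighted12 xP (fun e => (-1) ^+ z e : int).
  under eq_bigr => v _ do rewrite /chi signr_addb.
  rewrite -(sum_negative_edges s (fun e => (-1) ^+ z e) hM3).
  rewrite -[LHS]add0r -[X in X + _ = _]S1.
  rewrite -big_split; apply: eq_bigr => v _ /=.
  by rewrite /s (endpoint_sel hM1) (endpoint_sel hM3) !signr_addb; ring.
have [u /andP[neg_u chi_u] | all_theta] :=
    pickP (fun u => neg u && (chi u != theta)); last first.
  (* All terms of [sum_chi] are equal, so exactly two vertices are ends of
     negative edges; these are the two ends of one edge, and the sum for f0 is
     twice its value there, up to sign. *)
  have card_neg : #|[set v | neg v]| = 2%N.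
    have : \sum_(v in [set v | neg v]) (-1) ^+ theta = 2 * (-1) ^+ theta :> int.
      rewrite -sum_chi; apply: eq_big => [v|v]; rewrite inE // => neg_v.
      by have := all_theta v; rewrite /= neg_v => /negbFE/eqP->.
    rewrite sumr_const -[X in X = _]mulr_natl => /(mulIf (sign_neq0 int _))/eqP.
    by rewrite eqr_nat => /eqP.
  have /card_gt0P[u] : (0 < #|[set v | neg v]|)%N by rewrite card_neg.
  rewrite inE => neg_u.
  have negE : [set u; mate h3 u] = [set v | neg v].
    apply/eqP; rewrite eqEcard card_neg cards2 eq_sym (mate_neq hM3) leqnn andbT.
    by apply/subsetP => v; rewrite !inE => /orP[]/eqP->; rewrite ?neg_mate ?neg_u.
  have : \sum_(v | neg v) (-1) ^+ s (h3 v) * f0 (h3 v).1 = 0.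
    by rewrite -(sum_excess xP f0) big1 // => v _; rewrite f0_flow mulr0.
  rewrite (eq_bigl (fun v => v \in [set u; mate h3 u])) => [|v]; last first.
    by rewrite negE inE.
  rewrite big_setU1 ?big_set1 /=; last by rewrite inE eq_sym (mate_neq hM3).
  rewrite (sel_mate hM3) (eqP neg_u) /= -mulr2n => /eqP.
  by rewrite mulrn_eq0 /= mulf_eq0 signr_eq0 (negbTE (f0_neq0 _)).
(* The ends of the negative edge that gets doubled: both have sign opposite to
   the defect at r, hence differ from r. *)
pose w := mate h3 u.
have chi_w : chi w = chi u.
  by rewrite /chi (sel_mate hM3) (eqP neg_u).
have ur : u != r by apply: contra chi_u => /eqP->; rewrite chi_r.
have wr : w != r by apply: contra chi_u => /eqP wr; rewrite -chi_w wr chi_r.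
have uw : u != w by rewrite eq_sym (mate_neq hM3).
have [y1 y1P] := transfer xP theta ur.
have [y2 y2P] := transfer xP theta wr.
(* Half the sum of the two transfers. *)
pose psi e : int := if y1 e == y2 e then (-1) ^+ y1 e else 0.
have psiE e : 2 * psi e = (-1) ^+ y1 e + (-1) ^+ y2 e.
  by rewrite /psi; case: (y1 e); case: (y2 e).
have chordP v : (-1) ^+ x v * ((-1) ^+ tau (h3 v) * (-1) ^+ z (h3 v).1)
      * ((h3 v).1 == (h3 u).1)%:R
    = - (-1) ^+ theta * ((v == u)%:R + (v == w)%:R) :> int.
  have -> : (-1) ^+ x v * ((-1) ^+ tau (h3 v) * (-1) ^+ z (h3 v).1)
      = (-1) ^+ chi v :> int.
    by rewrite /chi /s (endpoint_sel hM3) !signr_addb mulrA.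
  rewrite (eq_sel_edge hM3) -/w.
  have [->|vu] := eqVneq v u.
    by rewrite (negbTE uw); move: chi_u; case: (chi u); case: (theta).
  have [->|vw] := eqVneq v w; last by rewrite !mulr0.
  by rewrite chi_w; move: chi_u; case: (chi u); case: (theta).
exists (by_factor (fun e => 3 * (-1) ^+ y e + (-1) ^+ z e + psi e)
  (fun e => 3 * (-1) ^+ y e + psi e)
  (fun e => (-1) ^+ z e * (1 + (e == (h3 u).1)%:R))); split=> [e|v].
  rewrite /by_factor /psi; case: ifP => _; [|case: ifP => _].
  - by case: (y e); case: (z e); case: (y1 e); case: (y2 e).
  - by case: (y e); case: (y1 e); case: (y2 e).
  - by case: (z e); case: eqP.
rewrite excess_by_factor.
apply: (mulfI (sign_neq0 int (x v))); apply: (@mulfI _ (2 : int)) => //.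
have y0 := signs_at_vertex int (yP v); rewrite /= mulr0 in y0.
(* Twice the boundary, collected by the patterns that make up the flow. *)
transitivity (6 * (-1) ^+ x v * ((-1) ^+ tau (h1 v) * (-1) ^+ y (h1 v).1
    + (-1) ^+ tau (h2 v) * (-1) ^+ y (h2 v).1)
  + 2 * ((-1) ^+ x v * ((-1) ^+ tau (h1 v) * (-1) ^+ z (h1 v).1
      + (-1) ^+ tau (h3 v) * (-1) ^+ z (h3 v).1))
  + (-1) ^+ x v * ((-1) ^+ tau (h1 v) * (2 * psi (h1 v).1)
      + (-1) ^+ tau (h2 v) * (2 * psi (h2 v).1))
  + 2 * ((-1) ^+ x v * ((-1) ^+ tau (h3 v) * (-1) ^+ z (h3 v).1)
      * ((h3 v).1 == (h3 u).1)%:R) : int); first by ring.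
rewrite y0 zP' !psiE chordP.
transitivity (4 * (-1) ^+ theta * (v == r)%:R
  + (-1) ^+ x v * ((-1) ^+ tau (h1 v) * (-1) ^+ y1 (h1 v).1
      + (-1) ^+ tau (h2 v) * (-1) ^+ y1 (h2 v).1)
  + (-1) ^+ x v * ((-1) ^+ tau (h1 v) * (-1) ^+ y2 (h1 v).1
      + (-1) ^+ tau (h2 v) * (-1) ^+ y2 (h2 v).1)
  - 2 * (-1) ^+ theta * ((v == u)%:R + (v == w)%:R) : int); first by ring.
by rewrite y1P y2P; ring.
Qed.

End ThreeFactors.
End Selectors.

(** * Integer flows on Kotzig graphs *)

(** Two of the three parities agree, and the three 1-factors play symmetric
    roles. *)
Lemma kotzig_integer_flow (A : numDomainType) (G : multigraph)
    (tau : halfedge G -> bool) (f0 : edge G -> A) :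
    kotzig G -> (forall e, f0 e != 0) -> (forall v, excess tau f0 v = 0) ->
  exists f : edge G -> int,
    (forall e, 1 <= `|f e| <= 5) /\ (forall v, excess tau f v = 0).
Proof.
case=> Gcubic [M1 [M2 [M3 [[F1 F2 F3] [ham12 ham13 ham23]]]]] f0_neq0 f0_flow.
have [h1 hM1] := one_factor_selects F1.
have [h2 hM2] := one_factor_selects F2.
have [h3 hM3] := one_factor_selects F3.
have [ham21 ham31 ham32] : [/\ hamiltonian_circuit (M2 :|: M1),
    hamiltonian_circuit (M3 :|: M1) & hamiltonian_circuit (M3 :|: M2)].
  by rewrite ![_ :|: M1]setUC [M3 :|: M2]setUC.
have [p12 | n12] := eqVneq (parity (tau \o h1)) (parity (tau \o h2)).
  have [p13 | n13] := eqVneq (parity (tau \o h1)) (parity (tau \o h3)).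
    exact: (equal_parity_flow hM1 hM2 hM3).
  exact: (odd_parity_flow hM1 hM2 hM3 _ _ _ _ _ f0_neq0).
have [p13 | n13] := eqVneq (parity (tau \o h1)) (parity (tau \o h3)).
  exact: (odd_parity_flow hM1 hM3 hM2 _ _ _ _ _ f0_neq0).
apply: (odd_parity_flow hM2 hM3 hM1 _ _ _ _ _ f0_neq0) => //.
  by move: n12 n13; do 3!case: (parity _).
by rewrite eq_sym.
Qed.

Lemma kotzig_six_flow (R : realType) (G : multigraph) (sigma : signature G) :
  flow_admissible R sigma -> kotzig G -> admits_integer_nz_flow R sigma 6.
Proof.
move=> [_ [tau [f0 [tau_or [_ _ f0_flow] f0_neq0]]]] Gkotzig.
have [f [f_bound f_flow]] := kotzig_integer_flow Gkotzig f0_neq0 f0_flow.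
have f_neq0 e : f e != 0.
  by apply: contraL (f_bound e) => /eqP->; rewrite normr0.
exists tau, (fun e => (f e)%:~R); split=> [//||e|e]; last exact: intr_int.
  split=> [|e|v]; first by rewrite (ler_nat R 2 6).
    right; have /andP[f_ge1 f_le5] := f_bound e.
    have -> : 6%:R - 1 = 5%:~R :> R by rewrite -[X in _ - X]/(1%:R) -natrB.
    by rewrite -intr_norm (ler_int R 1) ler_int f_ge1.
  transitivity ((excess tau f v)%:~R : R); last by rewrite f_flow.
  rewrite [RHS]rmorph_sum; apply: eq_bigr => k _.
  by rewrite rmorphM rmorph_sign.
by rewrite intr_eq0.
Qed.

Theorem theorem6p14 (R : realType) (G : multigraph) (sigma : signature G)
  (Gcubic : cubic G) (adm : flow_admissible R sigma) (Gkotzig : kotzig G) :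
  exists k : nat, is_integer_flow_number R sigma k /\ (k <= 6)%N.
Proof.
have flow6 := kotzig_six_flow adm Gkotzig.
have ex_flow : exists k, `[< admits_integer_nz_flow R sigma k >].
  by exists 6%N; apply/asboolP.
have [k /asboolP flow_k k_min] := ex_minnP ex_flow.
exists k; split; last by apply/k_min/asboolP.
by split=> // j flow_j; apply/k_min/asboolP.
Qed.
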